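(* Let $X$ and $Y$ be two $\omega$-homogeneous metric spaces having, up to isometry, the same finite metric subspaces. Then the topological group $\mathrm{Iso}(X)$ has the fixed point on compacta property if and only if the topological group $\mathrm{Iso}(Y)$ does.
   Context: A metric space $X$ is $\omega$-homogeneous if every isometry between two finite subspaces of $X$ extends to an isometry of $X$ onto itself. $\mathrm{Iso}(X)$ is the group of all isometries of $X$ onto itself, with the topology of pointwise convergence on $X$. A topological group has the fixed point on compacta property if every continuous action of it on a (nonempty) compact space has a fixed point. *)

(* Defs.v *)
From HB Require Import structures.
From mathcomp Require Import all_boot all_order all_algebra.
From mathcomp Require Import all_classical all_reals.
From mathcomp Require Import topology metric_structure function_spaces.

Set Implicit Arguments.
Unset Strict Implicit.
Unset Printing Implicit Defensive.

Import Order.TTheory GRing.Theory Num.Theory.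

Local Open Scope classical_set_scope.
Local Open Scope group_scope.

HB.mixin Record isTopologicalGroup G & Topological G & Group G := {
  mulg_continuous : continuous (fun p : G * G => p.1 * p.2) ;
  invg_continuous : continuous (fun g : G => g^-1)
}.

#[short(type="topologicalGroupType")]
HB.structure Definition TopologicalGroup :=
  {G of Topological G & Group G & isTopologicalGroup G}.

Definition continuous_action (G : topologicalGroupType) (K : topologicalType)
    (act : G -> K -> K) : Prop :=
  [/\ forall x, act 1 x = x,
      forall g h x, act (g * h) x = act g (act h x)
    & continuous (fun p : G * K => act p.1 p.2)].

(* As usual in topological dynamics, compact spaces are Hausdorff.  Without
   separation, only the trivial group would have the property, since a group
   acts continuously by translations on itself with the indiscrete topology. *)
Definition fixed_point_on_compacta (G : topologicalGroupType) : Prop :=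
  forall (K : topologicalType) (act : G -> K -> K),
    compact [set: K] -> hausdorff_space K -> [set: K] !=set0 ->
    continuous_action act ->
    exists x : K, forall g : G, act g x = x.

Section subspace_metric.
Context {R : realType} {X : metricType R} (A : set X).

Let dist (a b : A) : R := mdist (set_val a) (set_val b).

Let dist_ge0 a b : (0 <= dist a b)%R.
Proof. exact: mdist_ge0. Qed.

Let dist_positivity a b : dist a b = 0%R -> a = b.
Proof. by move=> /mdist_positivity ab; exact: val_inj. Qed.

Let ballEdist (a : A) d : ball a d = [set b | (dist a b < d)%R].
Proof. by rewrite [LHS]/(set_val @^-1` ball (set_val a) d) ballEmdist. Qed.

HB.instance Definition _ :=
  PseudoMetric_isMetric.Build R (A : Type) dist_ge0 dist_positivity ballEdist.

End subspace_metric.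

Definition isometry {R : realType} {M N : metricType R} (f : M -> N) : Prop :=
  bijective f /\ forall x y, mdist (f x) (f y) = mdist x y.

Section Iso.
Context {R : realType} (X : metricType R).

Record Iso := MkIso {
  Iso_fun :> X -> X ;
  Iso_isometry : isometry Iso_fun
}.

Lemma Iso_mdist (g : Iso) x y : mdist (g x) (g y) = mdist x y.
Proof. exact: (Iso_isometry g).2. Qed.

Lemma Iso_eqP (f g : Iso) : f =1 g -> f = g.
Proof.
case: f g => [f fP] [g gP] /= /funext fg; subst g.
by congr MkIso; exact: Prop_irrelevance.
Qed.

Lemma isometry_id : isometry (@id X).
Proof. by split=> //; exists id. Qed.

Lemma isometry_comp (g h : Iso) : isometry (g \o h).
Proof.
split=> [|x y]; last by rewrite /= !Iso_mdist.
exact: bij_comp (Iso_isometry g).1 (Iso_isometry h).1.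
Qed.

Lemma Iso_inverse (g : Iso) : {g' : X -> X | cancel g g' /\ cancel g' g}.
Proof. by apply: cid; case: (Iso_isometry g).1 => g' gK g'K; exists g'. Qed.

Definition Iso_inv_fun (g : Iso) : X -> X := sval (Iso_inverse g).

Lemma Iso_funK (g : Iso) : cancel g (Iso_inv_fun g).
Proof. exact: (svalP (Iso_inverse g)).1. Qed.

Lemma Iso_inv_funK (g : Iso) : cancel (Iso_inv_fun g) g.
Proof. exact: (svalP (Iso_inverse g)).2. Qed.

Lemma isometry_inv (g : Iso) : isometry (Iso_inv_fun g).
Proof.
split=> [|x y]; last by rewrite -(Iso_mdist g) !Iso_inv_funK.
exact: Bijective (@Iso_inv_funK g) (@Iso_funK g).
Qed.

Definition Iso_one : Iso := MkIso isometry_id.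
Definition Iso_mul (g h : Iso) : Iso := MkIso (isometry_comp g h).
Definition Iso_inv (g : Iso) : Iso := MkIso (isometry_inv g).

Lemma Iso_mulA : associative Iso_mul.
Proof. by move=> f g h; exact: Iso_eqP. Qed.

Lemma Iso_mul1g : left_id Iso_one Iso_mul.
Proof. by move=> f; exact: Iso_eqP. Qed.

Lemma Iso_mulg1 : right_id Iso_one Iso_mul.
Proof. by move=> f; exact: Iso_eqP. Qed.

Lemma Iso_mulVg : left_inverse Iso_one Iso_inv Iso_mul.
Proof. by move=> f; apply: Iso_eqP => x /=; exact: Iso_funK. Qed.

Lemma Iso_mulgV : right_inverse Iso_one Iso_inv Iso_mul.
Proof. by move=> f; apply: Iso_eqP => x /=; exact: Iso_inv_funK. Qed.

HB.instance Definition _ := gen_eqMixin Iso.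
HB.instance Definition _ := gen_choiceMixin Iso.
HB.instance Definition _ :=
  isGroup.Build Iso Iso_mulA Iso_mul1g Iso_mulg1 Iso_mulVg Iso_mulgV.
HB.instance Definition _ := Topological.copy Iso
  (initial_topology (Iso_fun : Iso -> {ptws X -> X})).

Lemma Iso_cvgP (F : set_system Iso) (g : Iso) : Filter F ->
  F --> g <-> forall x, (fun f : Iso => f x) @ F --> g x.
Proof.
move=> FF; split=> [Fg|Fg].
  apply/(pointwise_cvgP (F := Iso_fun @ F) g).
  have cF : continuous (Iso_fun : Iso -> {ptws X -> X}).
    exact: initial_continuous.
  exact: (cvg_trans (cvg_app _ Fg) (cF g)).
have /(pointwise_cvgP (F := Iso_fun @ F)) FgE :
    forall x, (fun f : X -> X => f x) @ (Iso_fun @ F) --> g x by exact: Fg.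
move=> A [_ [[B Bop <-] Bg sBA]].
by apply: filterS sBA _; apply: FgE; exact: open_nbhs_nbhs.
Qed.

Lemma Iso_eval_ball (g : Iso) x (e : R) : (0 < e)%R ->
  \forall f \near g, (mdist (g x) (Iso_fun f x) < e)%R.
Proof.
move=> e0; have /(Iso_cvgP (F := nbhs g))/(_ x) gx := @cvg_id _ (nbhs g).
have : \forall f \near g, ball (g x) e (Iso_fun f x).
  exact: gx _ (nbhsx_ballx (g x) e e0).
by apply: filterS => f; rewrite ballEmdist.
Qed.

Lemma Iso_mulg_continuous : continuous (fun p : Iso * Iso => p.1 * p.2).
Proof.
move=> [g h]; apply/Iso_cvgP => x; apply/cvg_ballP => e e0.
have e20 : (0 < e / 2)%R by rewrite divr_gt0.
have ng : \forall p \near ((g, h) : Iso * Iso),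
    (mdist (g (h x)) (Iso_fun p.1 (h x)) < e / 2)%R.
  exact: (cvg_fst (F := nbhs g) (G := nbhs h) (Iso_eval_ball g (h x) e20)).
have nh : \forall p \near ((g, h) : Iso * Iso),
    (mdist (h x) (Iso_fun p.2 x) < e / 2)%R.
  exact: (cvg_snd (F := nbhs g) (G := nbhs h) (Iso_eval_ball h x e20)).
apply: filterS2 ng nh => p pg ph.
rewrite ballEmdist /= [in ltRHS](splitr e).
apply: (le_lt_trans (metric_triangle _ (p.1 (h x)) _)).
by rewrite Iso_mdist; exact: ltrD.
Qed.

Lemma Iso_invg_continuous : continuous (fun g : Iso => g^-1).
Proof.
move=> g; have FF : Filter (g'^-1 @[g' --> g]).
  by apply: fmap_filter; exact: nbhs_filter.
apply/Iso_cvgP => x; apply/cvg_ballP => e e0.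
rewrite /=; have := Iso_eval_ball g (Iso_inv_fun g x) e0.
apply: filterS => f; rewrite ballEmdist /= Iso_inv_funK.
by rewrite -(Iso_mdist f (Iso_inv_fun g x)) Iso_inv_funK metric_sym.
Qed.

HB.instance Definition _ :=
  isTopologicalGroup.Build Iso Iso_mulg_continuous Iso_invg_continuous.

End Iso.

Definition omega_homogeneous {R : realType} (X : metricType R) : Prop :=
  forall (A B : set X) (f : A -> B),
    finite_set A -> finite_set B -> isometry f ->
    exists g : Iso X, forall a : A, g (set_val a) = set_val (f a).

Definition isometric {R : realType} (M N : metricType R) : Prop :=
  exists f : M -> N, isometry f.

Definition same_finite_subspaces {R : realType} (X Y : metricType R) : Prop :=
  (forall A : set X, finite_set A ->
     exists2 B : set Y, finite_set B & isometric A B) /\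
  (forall B : set Y, finite_set B ->
     exists2 A : set X, finite_set A & isometric A B).

(* Main.v *)
Require Import Defs.
From HB Require Import structures.
From mathcomp Require Import all_boot all_order all_algebra.
From mathcomp Require Import all_classical all_reals.
From mathcomp Require Import topology metric_structure function_spaces.
From mathcomp Require Import finmap normedtype lra.

(** By symmetry it is enough to carry the fixed point property from Iso(X) to
    Iso(Y).  Let Iso(Y) act on a compact space K containing a point x0.

    A fixed point exists as soon as, for finitely many isometries g_j of Y and
    continuous functions h_j from K to [0, 1], some point x of K satisfies
    |h_j(g_j x) - h_j(x)| <= 1/3 for all j (fixed_point_of_finite_approximations).
    The point x is sought in the orbit of x0.  Since the h_j hardly move under
    isometries close to 1, the number h_j(u^-1 x0) depends, up to a small error,
    only on the tuple u(F) for a suitable finite list F of points of Y.  So it is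
    approximated by f_j(u(F)) for a Lipschitz function f_j on all tuples of
    points of Y (lipschitz_approximation), and one needs u such that f_j takes
    nearly the same value at u(F) and u(g_j^-1(F)), for all j: a Ramsey-type
    statement about finite configurations of points, which can be tested in X.

    Every finite part of X embeds isometrically in Y.  Pulling f back along such
    embeddings and letting the finite parts grow yields, by compactness, limit
    functions on the tuples of points of X.  The set of all these limits is
    compact, invariant under Iso(X), and Iso(X) acts continuously on it because
    the limits are equi-Lipschitz.  Hence Iso(X) fixes a limit psi
    (invariant_pullback_limit).  Copy F and all the g_j^-1(F) in X.  By
    homogeneity of X the copies of F and g_j^-1(F) lie in one orbit, where psi is
    constant.  As psi is approximated by pullbacks of f, some copy in Y of the
    whole configuration is such that f_j nearly agrees on the copies of F and
    g_j^-1(F); by homogeneity of Y, this copy is the image of the original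
    configuration under an isometry u (fixed_point_transfer). *)

Set Implicit Arguments.
Unset Strict Implicit.
Unset Printing Implicit Defensive.

Import Order.TTheory GRing.Theory Num.Theory.
Import numFieldNormedType.Exports.

Local Open Scope classical_set_scope.
Local Open Scope ring_scope.

(** * Fixed points in compact flows *)

Section compact_flows.
Context (G : topologicalGroupType).

(** The flow to which the fixed point property gets applied is a compact subset
    [A] of a function space on which the action is jointly continuous only
    relatively to [A]; this spares the users of the property from working in
    the subtype [A]. *)
Lemma fixed_point_on_compact_subset (T : topologicalType) (A : set T)
    (act : G -> T -> T) :
  fixed_point_on_compacta G -> hausdorff_space T -> compact A -> A !=set0 ->
  (forall g x, A x -> A (act g x)) ->
  (forall x, A x -> act 1%g x = x) ->
  (forall g h x, A x -> act (g * h)%g x = act g (act h x)) ->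
  (forall g x U, A x -> nbhs (act g x) U ->
    \forall h \near g & y \near x, A y -> U (act h y)) ->
  exists2 x, A x & forall g, act g x = x.
Proof.
move=> fpG hT cA [a Aa] stA act1 actM actC.
have vA (x : A) : A (set_val x) by exact: set_valP.
pose act' g (x : A) : A := SigSub (mem_set (stA g _ (vA x))).
have val_act g x : set_val (act' g x) = act g (set_val x) by [].
have [] := fpG A act'.
- move=> F PF _.
  have PF' : ProperFilter (set_val @ F) by exact: fmap_proper_filter.
  have [|x [Ax clx]] := cA (set_val @ F) PF'.
    by apply: (@filterS _ F _ setT) => [x _|]; [exact: vA|exact: filterT].
  exists (SigSub (mem_set Ax)); split=> // B U FB [_ [[V oV <-] /= Vx VU]].
  have [||y [[z Bz <-] Vz]] := clx (set_val @` B) V.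
  - by apply: (@filterS _ F _ B) => // z Bz; exists z.
  - exact: open_nbhs_nbhs.
  - by exists z; split=> //; exact: VU.
- move=> x y xy; apply: val_inj; apply: hT => B C nB nC.
  have [z [Bz Cz]] := xy (set_val @^-1` B) (set_val @^-1` C)
    (initial_continuous nB) (initial_continuous nC).
  by exists (set_val z).
- by exists (SigSub (mem_set Aa)).
- split.
  + by move=> x; apply: val_inj; rewrite /= act1.
  + by move=> g h x; apply: val_inj; rewrite /= actM.
  + move=> [g x] U [_ [[V oV <-] /= Vx VU]].
    have [|[P Q] [/= nP nQ] PQ] := actC g (set_val x) V (vA x).
      exact: open_nbhs_nbhs.
    exists (P, set_val @^-1` Q); first by split=> //=; exact: initial_continuous.
    move=> [h y] [/= Ph Qy]; apply: VU => /=.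
    by rewrite val_act; apply: (PQ (h, set_val y) _ (vA y)).
move=> x fx; exists (set_val x) => // g.
by rewrite -val_act fx.
Qed.

Context (K : topologicalType) (act : G -> K -> K).
Hypotheses (cK : compact [set: K]) (actK : continuous_action act).

Lemma continuous_act g : continuous (act g).
Proof.
case: actK => _ _ cact x.
apply: (@continuous_comp _ _ _ (fun y => (g, y)) (fun p => act p.1 p.2)).
  by apply: cvg_pair; [exact: cvg_cst | exact: cvg_id].
exact: cact.
Qed.

(** Joint continuity at the points [(1, x)], made uniform in [x] by compactness:
    every observable [h] hardly moves under group elements near the identity. *)
Lemma uniform_displacement (R : realType) (h : K -> R) (e : R) :
  continuous h -> 0 < e ->
  \forall u \near (1%g : G), forall x, `|h (act u x) - h x| < e.
Proof.
move=> ch e0; case: actK => act1 _ cact.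
have /compact_near_coveringP cov := cK.
suff : \forall u \near (1%g : G),
    [set: K] `<=` [set x | `|h (act u x) - h x| < e].
  by apply: filterS => u hu x; exact: hu.
apply: (cov G _ (fun u x => `|h (act u x) - h x| < e)) => x _.
have cd : {for (x, 1%g : G), continuous (fun p => h (act p.2 p.1) - h p.1)}.
  apply: cvgB; last by apply: continuous_comp; [exact: cvg_fst|exact: ch].
  apply: continuous_comp; last exact: ch.
  apply: (@continuous_comp _ _ _ (fun p => (p.2, p.1)) (fun p => act p.1 p.2)).
    by apply: cvg_pair; [exact: cvg_snd|exact: cvg_fst].
  exact: cact.
have /cvgr_dist_lt/(_ e e0) := cd.
apply: filterS => -[y u] /=.
by rewrite act1 subrr sub0r normrN.
Qed.

(** If no point were fixed, every [x] would be moved by some [g], and a Urysohn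
    function [h] with values 0 at [x] and 1 at [g x] would witness the motion of
    all points near [x] by more than 1/3.  Finitely many such pairs [(g, h)]
    suffice to witness the motion of all points of [K], so it is enough to
    defeat finite families of witnesses. *)
Lemma fixed_point_of_finite_approximations (R : realType) :
  hausdorff_space K ->
  (forall (J : finType) (g : J -> G) (h : J -> K -> R),
    (forall j, continuous (h j)) -> (forall j x, 0 <= h j x <= 1) ->
    exists x, forall j, `|h j (act (g j) x) - h j x| <= 3^-1) ->
  exists x, forall g, act g x = x.
Proof.
move=> hK approx; apply: contrapT => /forallNP nofix.
have sep x : exists gh : G * (K -> R), [/\ continuous gh.2,
    forall y, 0 <= gh.2 y <= 1, gh.2 x = 0 & gh.2 (act gh.1 x) = 1].
  have /existsNP[g gx] := nofix x.
  have cl (y : K) : closed [set y].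
    exact: (accessible_closed_set1 (hausdorff_accessible hK)).
  have /(uniform_separatorP (R := R)) : uniform_separator [set x] [set act g x].
    apply: (normal_separatorP (R := R)).1 => //.
      exact: compact_normal.
    by rewrite -subset0 => y [-> xg]; exact: gx.
  case=> h [ch h01 h0 h1]; exists (g, h); split=> //=.
  - by move=> y; have /h01 := imageT h y; rewrite /= in_itv.
  - by apply: (h0 (h x)); exists x.
  - by apply: (h1 (h (act g x))); exists (act g x).
have {sep}[gh ghP] := choice sep.
pose O x := [set y | `|(gh x).2 (act (gh x).1 y) - (gh x).2 y| > 3^-1].
have oO x : open (O x).
  have [ch _ _ _] := ghP x.
  have cd : continuous (fun y => `|(gh x).2 (act (gh x).1 y) - (gh x).2 y|).
    move=> y; apply: cvg_norm; apply: cvgB; last exact: ch.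
    by apply: continuous_comp; [exact: continuous_act | exact: ch].
  exact: (open_comp (fun y _ => cd y) (@open_gt _ _)).
(* The empty family of witnesses provides a base point of K. *)
have [||x0 _] := approx void (fun=> 1%g) (fun _ _ => 0); try by case.
pose Kx0 : ptopologicalType :=
  HB.pack (Topological.sort K) (isPointed.Build _ x0).
have cK' : @cover_compact Kx0 [set: K] by rewrite -compact_cover.
have [x _|x _|D _ cov] := cK' K setT O; first exact: oO.
  exists x => //; rewrite /O /=.
  by have [_ _ -> ->] := ghP x; rewrite subr0 normr1; lra.
have [||x xP] := approx D (fun j => (gh (val j)).1) (fun j => (gh (val j)).2).
- by move=> j; have [] := ghP (val j).
- by move=> j; have [] := ghP (val j).
have [d /= Dd] := cov x I; rewrite /O /= ltNge => /negP; apply.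
exact: (xP [` Dd]%fset).
Qed.

End compact_flows.

(** * Lipschitz approximation and the topology of isometry groups *)

(** The McShane extension [sup_s (P s - d (p s) z / delta)], truncated below at
    0.  Since [P] is at most 1, the slope [delta^-1] makes the terms of the
    points [p s] at distance at least [delta] from [z] nonpositive; if [z] is
    some [p t], the other terms exceed [P t] by at most [e]. *)
Lemma lipschitz_approximation (R : realType) (S Z : Type) (p : S -> Z)
    (d : Z -> Z -> R) (P : S -> R) (delta e : R) :
  (forall x y, 0 <= d x y) -> (forall x, d x x = 0) ->
  (forall x y, d x y = d y x) -> (forall y x z, d x z <= d x y + d y z) ->
  0 < delta -> (forall s, 0 <= P s <= 1) ->
  (forall s t, d (p s) (p t) < delta -> `|P s - P t| <= e) -> 0 <= e ->
  exists f : Z -> R, [/\ forall z, 0 <= f z <= 1,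
    forall z w, `|f z - f w| <= delta^-1 * d z w &
    forall s, `|f (p s) - P s| <= e].
Proof.
move=> d0 dxx dC dT delta0 P01 Pe e0.
pose V z := [set 0] `|` [set P s - delta^-1 * d (p s) z | s in [set: S]].
have idelta0 : 0 < delta^-1 by rewrite invr_gt0.
have V0 z : V z !=set0 by exists 0; left.
have Vle1 z : ubound (V z) 1.
  move=> _ [->//|[s _ <-]].
  have /andP[_ Ps1] := P01 s.
  rewrite lerBlDr; apply: (le_trans Ps1).
  by rewrite lerDl mulr_ge0 ?(ltW idelta0).
have ubV z : has_ubound (V z) by exists 1; exact: Vle1.
have lip z w : sup (V z) <= sup (V w) + delta^-1 * d z w.
  apply: ge_sup => // _ [->|[s _ <-]].
    rewrite addr_ge0 ?mulr_ge0 ?(ltW idelta0)//.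
    by apply: ub_le_sup => //; left.
  rewrite -lerBlDr.
  apply: (@le_trans _ _ (P s - delta^-1 * d (p s) w)).
    by have := dT z (p s) w; rewrite -(ler_pM2l idelta0) mulrDr; lra.
  by apply: ub_le_sup => //; right; exists s.
exists (fun z => sup (V z)); split.
- by move=> z; rewrite ge_sup ?andbT//; apply: ub_le_sup => //; left.
- move=> z w; rewrite ler_norml; have := lip z w; have := lip w z.
  by rewrite (dC w); lra.
- move=> s; have /andP[Ps0 Ps1] := P01 s.
  have le1 : P s <= sup (V (p s)).
    by apply: ub_le_sup => //; right; exists s => //; rewrite dxx mulr0 subr0.
  have le2 : sup (V (p s)) <= P s + e.
    apply: ge_sup => // _ [->|[t _ <-]]; first exact: addr_ge0.
    have [lt|ge] := ltP (d (p t) (p s)) delta.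
      have := Pe t s lt; rewrite ler_norml => /andP[_].
      rewrite lerBlDl; apply: le_trans.
      by rewrite lerBlDr lerDl mulr_ge0 ?(ltW idelta0).
    have /andP[_ Pt1] := P01 t.
    rewrite (@le_trans _ _ 0) ?addr_ge0// subr_le0 (le_trans Pt1)//.
    by rewrite mulrC ler_pdivlMr ?mul1r.
  by rewrite ler_norml; lra.
Qed.

Section gap.
Context {R : realType}.

(** A tuple indexed by the finite list [F] is represented by a function defined
    on all of [S], of which only the values on [F] are seen by this
    pseudometric.  The tuple listing the points of [F] is then the identity, and
    the tuples obtained from it by an isometry [u] are [u] itself. *)
Definition gap {S : Type} {Z : metricType R} (F : seq S) (a b : S -> Z) : R :=
  \sum_(x <- F) mdist (a x) (b x).

Section gap_pseudometric.
Context {S : Type} {Z : metricType R} (F : seq S).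
Implicit Types a b c : S -> Z.

Lemma gap_ge0 a b : 0 <= gap F a b.
Proof. by apply: sumr_ge0 => x _; exact: mdist_ge0. Qed.

Lemma gapxx a : gap F a a = 0.
Proof. by rewrite /gap big1// => x _; rewrite mdistxx. Qed.

Lemma gapC a b : gap F a b = gap F b a.
Proof. by apply: eq_bigr => x _; rewrite metric_sym. Qed.

Lemma gap_triangle b a c : gap F a c <= gap F a b + gap F b c.
Proof.
by rewrite -big_split; apply: ler_sum => x _; exact: metric_triangle.
Qed.

End gap_pseudometric.

Lemma gap_eq0 {S : eqType} {Z : metricType R} (F : seq S) (a b : S -> Z) :
  {in F, a =1 b} -> gap F a b = 0.
Proof.
by move=> ab; rewrite /gap big_seq big1// => x /ab ->; rewrite mdistxx.
Qed.

Lemma gap_near {S : Type} {X : metricType R} (F : seq S) (a : S -> X)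
    (u : Iso X) (e : R) : 0 < e ->
  \forall v \near u, gap F (u \o a) (Iso_fun v \o a) < e.
Proof.
elim: F e => [|x F IH] e e0.
  by apply: (@nearW _ _ _ (nbhs_filter u)) => v; rewrite /gap big_nil.
have e20 : 0 < e / 2 by rewrite divr_gt0.
have := IH _ e20; have := Iso_eval_ball u (a x) e20.
apply: (filterS2 (nbhs_filter u)) => v ux uF; rewrite /gap big_cons.
by rewrite [in ltRHS](splitr e) ltrD.
Qed.

(** The sets [{u | gap F u id < delta}] form a filter converging pointwise to the
    identity, hence finer than the neighbourhoods of the identity. *)
Lemma nbhs1_gap {X : metricType R} (U : set (Iso X)) :
  nbhs (1%g : Iso X) U ->
  exists F : seq X, exists2 delta : R, 0 < delta &
    forall u : Iso X, gap F (Iso_fun u) id < delta -> U u.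
Proof.
pose B (p : seq X * R) := [set u : Iso X | gap p.1 (Iso_fun u) id < p.2].
pose N := filter_from [set p : seq X * R | 0 < p.2] B.
have FN : Filter N.
  apply: filter_from_filter; first by exists ([::], 1) => /=.
  move=> [F d] [F' d'] /= d0 d'0.
  exists (F ++ F', Num.min d d'); first by rewrite /= lt_min d0.
  move=> u; rewrite /B /= /gap big_cat lt_min => /andP[lt lt'].
  split.
    by apply: le_lt_trans lt; rewrite lerDl; exact: gap_ge0.
  by apply: le_lt_trans lt'; rewrite lerDr; exact: gap_ge0.
suff N1 : N --> (1%g : Iso X).
  by move=> /N1[[F d] /= d0 sub]; exists F; exists d.
apply/Iso_cvgP => x; apply/cvg_ballP => e e0.
exists ([:: x], e) => // u; rewrite /B /= /gap big_seq1.
by rewrite ballEmdist /= metric_sym.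
Qed.

End gap.

(** * Isometries between finite subspaces *)

Section finite_isometries.
Context {R : realType}.

Definition isometric_on {X Y : metricType R} (C : seq X) (i : X -> Y) : Prop :=
  {in C &, forall x y, mdist (i x) (i y) = mdist x y}.

Definition finitely_embeds (X Y : metricType R) : Prop :=
  forall C : seq X, exists i : X -> Y, isometric_on C i.

Lemma isometric_onS {X Y : metricType R} (C D : seq X) (i : X -> Y) :
  {subset C <= D} -> isometric_on D i -> isometric_on C i.
Proof. by move=> CD iso x y /CD xD /CD yD; exact: iso. Qed.

Lemma isometric_sym (M N : metricType R) : isometric M N -> isometric N M.
Proof.
move=> [f [[g fK gK] iso]]; exists g; split; first by exists f.
by move=> x y; rewrite -iso !gK.
Qed.

Lemma same_finite_subspaces_sym (X Y : metricType R) :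
  same_finite_subspaces X Y -> same_finite_subspaces Y X.
Proof.
move=> [XY YX]; split=> [B /YX[A fA]|A /XY[B fB]] /isometric_sym AB.
  by exists A.
by exists B.
Qed.

Lemma same_finite_subspaces_embeds (X Y : metricType R) :
  same_finite_subspaces X Y -> finitely_embeds X Y.
Proof.
move=> [XY _] C.
have [//|B _ [f [_ iso]]] := XY [set` C].
(* Y contains an isometric copy of the one-point subspace {x}. *)
have pt (x : X) : exists y : Y, True.
  have [//|D _ [h _]] := XY [set x].
  by exists (set_val (h (SigSub (mem_set (erefl x))))).
have ext x : exists y : Y,
    forall xC : x \in [set` C], y = set_val (f (SigSub xC)).
  have [xC|xC] := pselect (x \in [set` C]).
    exists (set_val (f (SigSub xC))) => xC'.
    by rewrite (bool_irrelevance xC xC').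
  by have [y _] := pt x; exists y => xC'; have := xC xC'.
have [i iP] := choice ext; exists i => x y xC yC.
have xC' : x \in [set` C] by exact: mem_set.
have yC' : y \in [set` C] by exact: mem_set.
by rewrite (iP _ xC') (iP _ yC') -[RHS](iso (SigSub xC') (SigSub yC')).
Qed.

(** Homogeneity stated for tuples instead of subsets: two tuples with the same
    mutual distances have the same repetitions, so matching their entries is an
    isometry between the underlying finite subspaces. *)
Lemma omega_homogeneous_tuples (X : metricType R) (S : eqType) (F : seq S)
    (a b : S -> X) :
  omega_homogeneous X ->
  {in F &, forall s t, mdist (a s) (a t) = mdist (b s) (b t)} ->
  exists g : Iso X, {in F, forall s, g (a s) = b s}.
Proof.
move=> hX ab.
pose A := a @` [set` F]; pose B := b @` [set` F].
have abE s t : s \in F -> t \in F -> (a s = a t) <-> (b s = b t).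
  move=> sF tF; split=> e; apply: mdist_positivity.
    by rewrite -ab// e mdistxx.
  by rewrite ab// e mdistxx.
have /choice[f fP] (x : A) : exists y : B,
    exists s, [/\ s \in F, a s = set_val x & b s = set_val y].
  have [s sF sx] : A (set_val x) by exact: set_valP.
  have Bs : B (b s) by exists s.
  by exists (SigSub (mem_set Bs)), s.
have /choice[f' f'P] (y : B) : exists x : A,
    exists s, [/\ s \in F, b s = set_val y & a s = set_val x].
  have [s sF sx] : B (set_val y) by exact: set_valP.
  have As : A (a s) by exists s.
  by exists (SigSub (mem_set As)), s.
have [|||g gP] := hX A B f.
- exact: finite_image.
- exact: finite_image.
- split.
    exists f' => x; apply: val_inj.
      have [s [sF sx sfx]] := fP x; have [t [tF tx tfx]] := f'P (f x).
      by rewrite -[RHS]sx -[LHS]tfx; apply/abE => //; rewrite tx.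
    have [s [sF sx sfx]] := f'P x; have [t [tF tx tfx]] := fP (f' x).
    by rewrite -[RHS]sx -[LHS]tfx; apply/abE => //; rewrite tx.
  move=> x y; have [s [sF sx sfx]] := fP x; have [t [tF ty tfy]] := fP y.
  rewrite -[LHS]/(mdist (set_val (f x)) (set_val (f y))) -sfx -tfy.
  by rewrite -[RHS]/(mdist (set_val x) (set_val y)) -sx -ty ab.
exists g => s sF.
have As : A (a s) by exists s.
have [t [tF ts tfs]] := fP (SigSub (mem_set As)).
by rewrite (gP (SigSub (mem_set As))) -tfs; apply/abE.
Qed.

End finite_isometries.

(** * Limits of pullbacks along finite embeddings *)

Lemma ptws_cvgP {U : eqType} {V : topologicalType} (F : set_system (U -> V))
    (f : U -> V) : Filter F ->
  F --> (f : {ptws U -> V}) <-> forall t, g t @[g --> F] --> f t.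
Proof.
move=> FF; split=> [Ff t|Ff].
  exact: (cvg_trans (cvg_app _ Ff) (@proj_continuous U (fun=> V) t f)).
apply/cvg_sup => t A [_ [[B oB <-] Bf] sBA].
by apply: (filterS sBA); apply: Ff; exact: open_nbhs_nbhs.
Qed.

Section limits_of_pullbacks.
Context {R : realType} {X Y : metricType R} {J : Type} (F : seq Y) (L : R)
  (f : J -> (Y -> Y) -> R).
Hypotheses (L0 : 0 < L) (f01 : forall j a, 0 <= f j a <= 1)
  (fL : forall j a b, `|f j a - f j b| <= L * gap F a b)
  (embXY : finitely_embeds X Y).

(** The index type carries all coordinates [(j, a)] of a function on tuples of
    points of [X] with values in [R ^ J]: composing the tuple [a] with
    [i : X -> Y] yields a tuple of points of [Y], to which [f j] applies. *)
Let T := {classic (J * (Y -> X))}.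

Definition pullback (i : X -> Y) : {ptws T -> R} := fun t => f t.1 (i \o t.2).

(** The filter along which maps become isometric embeddings of larger and larger
    finite parts of [X]. *)
Definition near_embeddings : set_system (X -> Y) :=
  filter_from [set: seq X] (fun C => [set i | isometric_on C i]).

Definition pullback_limits : set {ptws T -> R} :=
  cluster (pullback @ near_embeddings).

Definition translate (u : Iso X) (psi : {ptws T -> R}) : {ptws T -> R} :=
  fun t => psi (t.1, Iso_fun u^-1%g \o t.2).

Lemma near_embeddings_proper : ProperFilter near_embeddings.
Proof.
apply: filter_from_proper; last by move=> C _; exact: embXY.
apply: filter_from_filter; first by exists [::].
move=> C D _ _; exists (C ++ D) => // i iso; split.
  by apply: isometric_onS iso => x xC; rewrite mem_cat xC.
by apply: isometric_onS iso => x xD; rewrite mem_cat xD orbT.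
Qed.

Lemma ptws_near (psi : {ptws T -> R}) (t : T) (e : R) : 0 < e ->
  \forall phi \near psi, `|psi t - phi t| < e.
Proof.
have /(ptws_cvgP (U := T) psi (nbhs_filter psi))/(_ t) := @cvg_id _ (nbhs psi).
by move=> /cvgr_dist_lt; apply.
Qed.

(** A limit is only ever looked at through finitely many coordinates, and there
    it is approximated by the pullback along a genuine isometric embedding of
    any prescribed finite part of [X]. *)
Lemma pullback_limits_approx psi (C : seq X) (I : finType) (t : I -> T)
    (e : R) :
  pullback_limits psi -> 0 < e ->
  exists2 i, isometric_on C i & forall n, `|psi (t n) - pullback i (t n)| < e.
Proof.
move=> psiL e0.
have [||phi [[i iso <-] near_psi]] :=
  psiL (pullback @` [set i | isometric_on C i])
    [set phi | forall n, `|psi (t n) - phi (t n)| < e].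
- by exists C => // i iso; exists i.
- by apply: (filter_forall (nbhs_filter psi)) => n; exact: ptws_near.
- by exists i.
Qed.

(** The Lipschitz bound of [f] passes to the limit because the embeddings near
    the limit preserve the distances between the entries of [a] and [b]. *)
Lemma pullback_limits_lipschitz psi j (a b : Y -> X) :
  pullback_limits psi -> `|psi (j, a) - psi (j, b)| <= L * gap F a b.
Proof.
move=> psiL; apply/ler_addgt0Pl => e e0.
have e20 : 0 < e / 2 by rewrite divr_gt0.
have [i iso near_psi] := pullback_limits_approx
  ([seq a x | x <- F] ++ [seq b x | x <- F])
  (fun c => (j, if c then a else b)) psiL e20.
have gapE : gap F (i \o a) (i \o b) = gap F a b.
  rewrite /gap big_seq [RHS]big_seq; apply: eq_bigr => x xF /=.
  by apply: iso; rewrite mem_cat map_f ?orbT.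
have := near_psi true; have := near_psi false.
have := fL j (i \o a) (i \o b); rewrite gapE /pullback /=.
rewrite !ler_norml !ltr_norml; lra.
Qed.

Let box := [set psi : {ptws T -> R} | forall t, `[0, 1]%classic (psi t)].

Let box_compact : compact box.
Proof.
apply: (@tychonoff T (fun=> R) (fun=> `[0, 1]%classic)) => t.
exact: segment_compact.
Qed.

Let box_pullback i : box (pullback i).
Proof. by move=> t /=; rewrite in_itv /=; exact: f01. Qed.

Lemma pullback_limits_compact : compact pullback_limits.
Proof.
apply: (subclosed_compact _ box_compact).
  rewrite /pullback_limits clusterE; apply: closed_bigI => B _.
  exact: closed_closure.
move=> psi psiL t /=; rewrite in_itv /=; apply/andP.
have approx e : 0 < e -> exists r, 0 <= r <= 1 /\ `|psi t - r| < e.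
  move=> e0; have [i _ near_psi] :=
    pullback_limits_approx [::] (fun _ : unit => t) psiL e0.
  by exists (pullback i t); split; [exact: f01|exact: near_psi tt].
split; apply/ler_addgt0Pl => e /approx[r [/andP[r0 r1]]];
  rewrite ltr_norml; lra.
Qed.

Lemma pullback_limits_nonempty : pullback_limits !=set0.
Proof.
have PF : ProperFilter (pullback @ near_embeddings).
  by apply: fmap_proper_filter; exact: near_embeddings_proper.
have [|psi [_ psiL]] := box_compact PF; last by exists psi.
by exists [::] => // i _; exact: box_pullback.
Qed.

(** Translating by [u] amounts to precomposing the embeddings with [u^-1], which
    leaves the filter of near embeddings invariant: the list [C] is replaced by
    its image under [u^-1]. *)
Lemma translate_pullback_limits u psi :
  pullback_limits psi -> pullback_limits (translate u psi).
Proof.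
move=> psiL B V FB nV.
have tc : continuous (translate u).
  move=> phi; have FF : Filter (translate u @ nbhs phi).
    by apply: fmap_filter; exact: nbhs_filter.
  apply: (ptws_cvgP (U := T) (translate u phi) FF).2 => t.
  exact: (@proj_continuous T (fun=> R) (t.1, Iso_fun u^-1%g \o t.2) phi).
have [||phi [Bphi Vphi]] := psiL (translate u @^-1` B) (translate u @^-1` V).
- have [C _ CB] := FB.
  exists [seq Iso_fun u^-1%g x | x <- C] => // i iso.
  apply: (CB (i \o Iso_fun u^-1%g)) => x y xC yC.
  by rewrite -[RHS](Iso_mdist u^-1%g); apply: iso; exact: map_f.
- exact: tc.
- by exists (translate u phi).
Qed.

(** The Lipschitz bound is what makes the action jointly continuous on the set
    of limits: moving [u] slightly moves the tuple [u^-1 \o a] slightly, and this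
    affects all the limits equally little. *)
Lemma translate_continuous_within u psi U :
  pullback_limits psi -> nbhs (translate u psi) U ->
  \forall v \near u & phi \near psi, pullback_limits phi -> U (translate v phi).
Proof.
move=> psiL nU.
pose N := within (fun p : Iso X * {ptws T -> R} => pullback_limits p.2)
  (filter_prod (nbhs u) (nbhs psi)).
have FN : Filter N.
  exact: (within_filter _ (filter_prod_filter (nbhs_filter u) (nbhs_filter psi))).
have FN' : Filter (translate p.1 p.2 @[p --> N]) by exact: (fmap_filter _ FN).
suff cv : translate p.1 p.2 @[p --> N] --> translate u psi by exact: cv nU.
apply: (ptws_cvgP (U := T) (translate u psi) FN').2 => -[j a].
apply/cvgrPdist_lt => e e0.
have e20 : 0 < e / 2 by rewrite divr_gt0.
pose ua := Iso_fun u^-1%g \o a.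
have nv : \forall v \near u, gap F ua (Iso_fun v^-1%g \o a) < L^-1 * (e / 2).
  have eL0 : 0 < L^-1 * (e / 2) by rewrite mulr_gt0 ?invr_gt0.
  exact: (@Iso_invg_continuous _ X u _ (gap_near F a u^-1%g eL0)).
have nphi := ptws_near psi (j, ua) e20.
exists ([set v | gap F ua (Iso_fun v^-1%g \o a) < L^-1 * (e / 2)],
  [set phi | `|psi (j, ua) - phi (j, ua)| < e / 2]); first by [].
move=> [v phi] [/= + near_phi] phiL.
have := pullback_limits_lipschitz j ua (Iso_fun v^-1%g \o a) phiL.
have := ler_distD (phi (j, ua)) (psi (j, ua)) (phi (j, Iso_fun v^-1%g \o a)).
rewrite /translate /= -/ua => dist_le lip.
by rewrite mulrC ltr_pdivlMr// mulrC => gv; lra.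
Qed.

(** The fixed point property of [Iso X] enters here, applied to the flow of
    limits by translations. *)
Lemma invariant_pullback_limit : fixed_point_on_compacta (Iso X) ->
  exists2 psi, pullback_limits psi &
    forall (u : Iso X) j a, psi (j, Iso_fun u \o a) = psi (j, a).
Proof.
move=> fpX.
have [|||||||psi psiL fix_psi] := fixed_point_on_compact_subset (A := pullback_limits)
  (act := translate) fpX.
- exact: (@hausdorff_product T (fun=> R) (fun=> @Rhausdorff R)).
- exact: pullback_limits_compact.
- exact: pullback_limits_nonempty.
- exact: translate_pullback_limits.
- move=> psi _; apply/funext => -[j a]; rewrite /translate invg1; congr psi.
- move=> u v psi _; apply/funext => -[j a]; rewrite /translate invgM; congr psi.
- exact: translate_continuous_within.
exists psi => // u j a; rewrite -[in LHS](fix_psi u) /translate /=.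
congr (psi (_, _)); apply/funext => y /=; exact: Iso_funK.
Qed.

End limits_of_pullbacks.

(** * Transfer of the fixed point property *)

(** A flow of [Iso Y] is turned into one of [Iso X] by observing an orbit through
    finitely many functions, as functions of tuples in [Y], and pulling these
    back to [X].  An invariant limit says that in [Y] there is a copy [i \o k] of
    any finite configuration [B] on which the observations hardly distinguish
    the tuple [F] from its translates by the [(g j)^-1].  By homogeneity the copy
    is the image of [B] under an isometry [u] of [Y], so that the observations
    hardly distinguish [u^-1 x0] from its translates by the [g j]. *)
Lemma fixed_point_transfer (R : realType) (X Y : metricType R) :
  omega_homogeneous X -> omega_homogeneous Y ->
  finitely_embeds X Y -> finitely_embeds Y X ->
  fixed_point_on_compacta (Iso X) -> fixed_point_on_compacta (Iso Y).
Proof.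
move=> hX hY embXY embYX fpX K act cK hK [x0 _] actK.
case: (actK) => act1 actM _.
apply: (fixed_point_of_finite_approximations cK actK (R := R) hK) => J g h ch h01.
(* Four errors of size at most e add up to 1/3: two come from replacing the
   observations by Lipschitz functions, two from replacing the limit by a
   pullback. *)
pose e : R := 12^-1.
have e0 : 0 < e by rewrite invr_gt0.
have : \forall u \near (1%g : Iso Y), forall j x, `|h j (act u x) - h j x| < e.
  apply: (filter_forall (nbhs_filter (1%g : Iso Y))) => j.
  exact: (uniform_displacement cK actK (ch j) e0).
move=> /nbhs1_gap[F [delta delta0 small]].
(* The observations depend on the inverse of the isometry, so that two
   isometries that are close on F differ, for the purpose of observing, by an
   isometry close to 1 acting on the left. *)
have /choice[f fP] (j : J) : exists f : (Y -> Y) -> R, [/\ forall a, 0 <= f a <= 1,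
    forall a b, `|f a - f b| <= delta^-1 * gap F a b &
    forall u : Iso Y, `|f (Iso_fun u) - h j (act u^-1%g x0)| <= e].
  apply: (lipschitz_approximation (p := @Iso_fun _ Y)
    (P := fun u => h j (act u^-1%g x0)) (delta := delta)) => //.
  - exact: gap_ge0.
  - exact: gapxx.
  - exact: gapC.
  - exact: gap_triangle.
  - move=> s t st; apply: ltW.
    have -> : act s^-1%g x0 = act (s^-1 * t)%g (act t^-1%g x0).
      by rewrite -actM mulgK.
    apply: small; move: st; rewrite gapC; congr (_ < _); apply: eq_bigr => x _.
    by rewrite -[RHS](Iso_mdist s) /= Iso_inv_funK.
  - exact: ltW.
have f01 j a : 0 <= f j a <= 1 by have [] := fP j.
have fL j a b : `|f j a - f j b| <= delta^-1 * gap F a b by have [] := fP j.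
have fh j (u : Iso Y) : `|f j (Iso_fun u) - h j (act u^-1%g x0)| <= e.
  by have [] := fP j.
have f_local j a b : {in F, a =1 b} -> f j a = f j b.
  move=> ab; have := fL j a b.
  by rewrite (gap_eq0 ab) mulr0 normr_le0 subr_eq0 => /eqP.
have idelta0 : 0 < delta^-1 by rewrite invr_gt0.
have [psi psiL inv_psi] := invariant_pullback_limit idelta0 f01 fL embXY fpX.
pose B := F ++ flatten [seq [seq Iso_fun (g j)^-1%g y | y <- F] | j <- enum J].
have FB : {subset F <= B} by move=> y yF; rewrite mem_cat yF.
have gFB j y : y \in F -> Iso_fun (g j)^-1%g y \in B.
  move=> yF; rewrite mem_cat; apply/orP; right; apply/flatten_mapP.
  by exists j; [rewrite mem_enum|exact: map_f].
have [k isok] := embYX B.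
have psi_k j : psi (j, k \o Iso_fun (g j)^-1%g) = psi (j, k).
  have [v vP] : exists v : Iso X,
      {in F, forall y, v (k y) = k (Iso_fun (g j)^-1%g y)}.
    apply: (omega_homogeneous_tuples hX) => y z yF zF.
    rewrite isok ?FB// isok ?gFB//.
    by rewrite [RHS]Iso_mdist.
  have := pullback_limits_lipschitz fL j (Iso_fun v \o k)
    (k \o Iso_fun (g j)^-1%g) psiL.
  rewrite (gap_eq0 vP) mulr0 normr_le0 subr_eq0 => /eqP <-.
  exact: inv_psi.
have [i isoi near_psi] := pullback_limits_approx [seq k y | y <- B]
  (fun n : J * bool => (n.1, if n.2 then k else k \o Iso_fun (g n.1)^-1%g))
  psiL e0.
have [u uP] : exists u : Iso Y, {in B, forall y, u y = i (k y)}.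
  apply: (omega_homogeneous_tuples (a := id) hY) => y z yB zB.
  by rewrite isoi ?map_f// isok.
exists (act u^-1%g x0) => j.
have near1 : `|psi (j, k) - f j (Iso_fun u)| < e.
  have := near_psi (j, true).
  by rewrite /pullback /= (@f_local _ _ (Iso_fun u))// => y /FB /uP.
have near2 : `|psi (j, k) - f j (Iso_fun (u * (g j)^-1)%g)| < e.
  have := near_psi (j, false).
  rewrite psi_k /pullback /= (@f_local _ _ (Iso_fun (u * (g j)^-1)%g))// => y yF.
  exact: (esym (uP _ (gFB j y yF))).
have := fh j u; have := fh j (u * (g j)^-1)%g.
rewrite invgM invgK actM; move: near1 near2.
rewrite /e !ltr_norml !ler_norml; lra.
Qed.

Theorem theorem6p5 (R : realType) (X Y : metricType R)
    (hX : omega_homogeneous X) (hY : omega_homogeneous Y)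
    (hXY : same_finite_subspaces X Y) :
  fixed_point_on_compacta (Iso X) <-> fixed_point_on_compacta (Iso Y).
Proof.
have embXY := same_finite_subspaces_embeds hXY.
have embYX := same_finite_subspaces_embeds (same_finite_subspaces_sym hXY).
by split; apply: fixed_point_transfer.
Qed.
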